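(* Let $G$ be a countable group and $X$ a countably infinite set. Then $G$ is A-separable if and only if for a generic action of $G$ on $X$ the action on every orbit is amenable; that is, if and only if the set of all $\sigma\in \mathrm{Hom}(G,X!)$ such that for every $x\in X$ the action of $G$ on the orbit $\sigma(G)x$ is amenable is co-meager in $\mathrm{Hom}(G,X!)$.
   Context: $\mathrm{Sub}(G)$ is the set of all subgroups of $G$ with the Chabauty topology, i.e. the topology induced from the product topology on $\{0,1\}^G$. An action of a countable discrete group $G$ on a set $Y$ is amenable if there is a finitely additive $G$-invariant probability measure defined on all subsets of $Y$ (equivalently, for every $\epsilon>0$ and finite $\Omega\subseteq G$ there is a finite nonempty $F\subseteq Y$ with $|gF\,\triangle\, F|<\epsilon|F|$ for all $g\in\Omega$). A subgroup $K\le G$ is co-amenable if the action of $G$ on $G/K$ is amenable. $G$ is A-separable (amenably separable) if the set of co-amenable subgroups of $G$ is dense in $\mathrm{Sub}(G)$. $X!$ is the group of all permutations of $X$ with the topology of pointwise convergence; $\mathrm{Hom}(G,X!)$ carries the topology of pointwise convergence (as a closed subspace of $(X!)^G$) and is a Polish space. Co-meager means containing a countable intersection of dense open sets. *)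

(* Defs.v *)
From HB Require Import structures.
From mathcomp Require Import all_boot ssralg ssrnum.
From mathcomp Require Import boolp classical_sets functions cardinality.
From mathcomp Require Import reals topology borel_hierarchy.

Set Implicit Arguments.
Unset Strict Implicit.
Unset Printing Implicit Defensive.

Local Open Scope classical_set_scope.
Local Open Scope group_scope.

(* The action [act] of [G] is restricted to a [G]-invariant set [Y]:
   only the values of [m] on the subsets of [Y] are constrained. *)
Definition amenable (R : realType) (G : groupType) (T : Type)
    (act : G -> T -> T) (Y : set T) : Prop :=
  exists m : set T -> R,
    [/\ m Y = 1%R,
        forall A, A `<=` Y -> (0 <= m A)%R,
        forall A B, A `<=` Y -> B `<=` Y -> A `&` B = set0 ->
          m (A `|` B) = (m A + m B)%R
      & forall g A, A `<=` Y -> m (act g @` A) = m A].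

Section subgroups.
Variables (R : realType) (G : groupType).

(* The Chabauty topology: a subgroup is encoded by its indicator function. *)
Definition subgroup_space : Type :=
  set_type [set K : {ptws G -> bool} | group_closed K].

HB.instance Definition _ := Topological.on subgroup_space.

Definition left_cosets (K : subgroup_space) : set (set G) :=
  range (fun g : G => [set g * k | k in [set k | val K k]]).

Definition coamenable (K : subgroup_space) : Prop :=
  amenable R (fun (g : G) (C : set G) => [set g * c | c in C]) (left_cosets K).

Definition A_separable : Prop := dense [set K : subgroup_space | coamenable K].

End subgroups.

Section permutations.
Variable X : choiceType.

Definition perms : Type :=
  set_type [set f : {ptws X -> discrete_topology X} | bijective f].

HB.instance Definition _ := Topological.on perms.

Definition perm_fun (s : perms) : X -> X := val s.

Lemma perm_fun_inj : injective perm_fun.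
Proof. exact: val_inj. Qed.

Lemma perm_fun_bij (s : perms) : bijective (perm_fun s).
Proof. by have := valP s; rewrite inE. Qed.

Definition mk_perm (f : X -> X) (bf : bijective f) : perms :=
  exist _ (f : {ptws X -> discrete_topology X}) (mem_set bf).

Lemma mk_permE f (bf : bijective f) : perm_fun (mk_perm bf) = f.
Proof. by []. Qed.

Definition perm_one : perms := mk_perm (inv_bij (frefl _ : involutive id)).

Definition perm_mul (s t : perms) : perms :=
  mk_perm (bij_comp (perm_fun_bij s) (perm_fun_bij t)).

Lemma perm_inv_subproof (s : perms) :
  {t : X -> X | cancel (perm_fun s) t & cancel t (perm_fun s)}.
Proof.
apply/cid2; have [t sK tK] := perm_fun_bij s.
by exists t.
Qed.

Definition perm_inv (s : perms) : perms :=
  let: exist2 t sK tK := perm_inv_subproof s in mk_perm (Bijective tK sK).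

Lemma perm_mulA : associative perm_mul.
Proof. by move=> s t u; apply: perm_fun_inj. Qed.

Lemma perm_mul1 : left_id perm_one perm_mul.
Proof. by move=> s; apply: perm_fun_inj. Qed.

Lemma perm_mulr1 : right_id perm_one perm_mul.
Proof. by move=> s; apply: perm_fun_inj. Qed.

Lemma perm_mulV : left_inverse perm_one perm_inv perm_mul.
Proof.
move=> s; apply: perm_fun_inj; rewrite /perm_inv.
by case: perm_inv_subproof => t sK tK; apply/funext => x; exact: sK.
Qed.

Lemma perm_mulrV : right_inverse perm_one perm_inv perm_mul.
Proof.
move=> s; apply: perm_fun_inj; rewrite /perm_inv.
by case: perm_inv_subproof => t sK tK; apply/funext => x; exact: tK.
Qed.

(* [s * t] is the composition [perm_fun s \o perm_fun t], so that
   homomorphisms to [perms] are left actions. *)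
HB.instance Definition _ := isGroup.Build perms
  perm_mulA perm_mul1 perm_mulr1 perm_mulV perm_mulrV.

End permutations.

Definition hom_space (G : groupType) (X : choiceType) : Type :=
  set_type [set s : {ptws G -> perms X} | monoid_morphism s].

HB.instance Definition _ (G : groupType) (X : choiceType) :=
  Topological.on (hom_space G X).

Definition action_of (G : groupType) (X : choiceType) (s : hom_space G X)
  (g : G) (x : X) : X := perm_fun (val s g) x.

Definition orbit_of (G : groupType) (X : choiceType) (s : hom_space G X)
  (x : X) : set X := range (fun g => action_of s g x).

Definition comeager (T : topologicalType) (A : set T) : Prop :=
  exists2 B : set T, Gdelta_dense B & B `<=` A.

(* Main.v *)
Require Import Defs.
From mathcomp Require Import all_boot order ssralg ssrnum interval finmap zify.
From mathcomp Require Import boolp classical_sets functions cardinality.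
From mathcomp Require Import reals topology normedtype.

(* The action on the orbit of x is conjugate to the action on G / Stab(x), so
   it is amenable exactly when Stab(x) is co-amenable. Amenability of the orbit
   is equivalent to the Folner condition, and for fixed x, finite subset of G
   and precision that condition is open in Hom(G, X!); hence amenability on all
   orbits is a countable intersection of open conditions.
   Each of them is dense if G is A-separable: given an action s0 on X and a
   co-amenable K close to the stabilizer of x, the action on the disjoint union
   of G / K and X can be identified with an action on X which agrees with s0 on
   a prescribed finite set and for which x has stabilizer K.
   Conversely, any K is the stabilizer of a point x in some action on X (glue
   G / K to a trivial action); a nearby generic action exists by a Baire
   argument, and its stabilizer at x is co-amenable and close to K. *)

Set Implicit Arguments.
Unset Strict Implicit.
Unset Printing Implicit Defensive.

Import Order.TTheory GRing.Theory Num.Theory.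
Import numFieldNormedType.Exports.

(** * Cylinder neighbourhoods in Sub(G) and Hom(G, X!) *)

Section pointwise_convergence.
Local Open Scope classical_set_scope.
Local Open Scope group_scope.

Lemma ptws_cvg (I : Type) (V : topologicalType)
    (F : set_system {ptws I -> V}) (f : {ptws I -> V}) :
  Filter F -> (forall i, (fun g => g i) @ F --> f i) -> F --> f.
Proof.
move=> FF Ff; apply/cvg_sup => i A /=.
rewrite (@nbhsE (initial_topology (fun g : {ptws I -> V} => g i))).
move=> -[_ [[C oC <-] Cf] sCA]; apply: filterS sCA _.
by apply: (Ff i); exact: open_nbhs_nbhs.
Qed.

Lemma set_type_cvg (T : topologicalType) (A : set T)
    (F : set_system (set_type A)) (s : set_type A) :
  Filter F -> (val @ F --> val s) -> F --> s.
Proof.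
move=> FF Fs B; rewrite nbhsE => -[_ [[C oC <-] Cs] sCB]; apply: filterS sCB _.
by apply: Fs; exact: open_nbhs_nbhs.
Qed.

Lemma val_continuous (T : topologicalType) (A : set T) :
  continuous (val : set_type A -> T).
Proof. exact: initial_continuous. Qed.

Lemma ptws_eval_continuous (I : Type) (V : topologicalType) (i : I) :
  continuous (fun f : {ptws I -> V} => f i).
Proof.
move=> f A; rewrite nbhsE => -[C [oC Cf] CA].
have /cvg_sup/(_ i) : f --> f by apply: cvg_id.
apply; rewrite nbhsE; exists ((fun f => f i) @^-1` C) => //.
  by split=> //; exists C.
by move=> g; apply: CA.
Qed.

Section finite_agreement.
Variables (S T : Type) (I : choiceType) (e : S -> I -> T).

(** Basic cylinder sets for an abstract evaluation map [e], instantiated by [sub_mem] for subgroups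
    and by [eval] for actions. *)
Definition agree (s : S) (D : seq I) : set S :=
  [set t | forall i, i \in D -> e t i = e s i].

Lemma agree_filter s : Filter (filter_from [set: seq I] (agree s)).
Proof.
apply: filter_fromT_filter; first by exists [::].
move=> D1 D2; exists (D1 ++ D2) => t st; split=> i Di; apply: st.
  by rewrite mem_cat Di.
by rewrite mem_cat Di orbT.
Qed.

End finite_agreement.

Lemma agree_open (S : topologicalType) (T : Type) (I : choiceType)
    (e : S -> I -> T) (s : S) (D : seq I) :
  (forall i y, open [set s | e s i = y]) -> open (agree e s D).
Proof.
move=> oe; elim: D => [|p D IH].
  by rewrite (_ : agree _ _ _ = setT); [exact: openT|apply/seteqP; split].
rewrite (_ : agree _ _ _ = [set t | e t p = e s p] `&` agree e s D).
  by apply: openI => //; exact: oe.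
apply/seteqP; split=> t /=.
  by move=> st; split=> [|i iD]; apply: st; rewrite inE ?eqxx ?iD ?orbT.
by move=> [tp st] i; rewrite inE => /orP[/eqP->|/st].
Qed.

Definition sub_mem (G : groupType) (K : subgroup_space G) (g : G) : bool :=
  val K g.

(** Convergence to [K] can be tested at each [g], and the cylinder on [[:: g]] already fixes the
    value there; so the filter generated by the cylinders converges to [K]. *)
Lemma nbhs_subgroup (G : groupType) (K : subgroup_space G)
    (U : set (subgroup_space G)) :
  nbhs K U -> exists D, agree (@sub_mem G) K D `<=` U.
Proof.
suff H : filter_from setT (agree (@sub_mem G) K) --> K.
  by move=> /H[D _]; exists D.
have FF := agree_filter (@sub_mem G) K.
apply: set_type_cvg; apply: ptws_cvg => g A /= /principal_filterP AK.
exists [:: g] => // L /(_ g); rewrite inE eqxx => /(_ isT) /= LK.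
by rewrite /= -[val L g]/(sub_mem L g) LK.
Qed.

Lemma sub_mem_open (G : groupType) (g : G) (b : bool) :
  open [set K : subgroup_space G | sub_mem K g = b].
Proof.
have c : continuous (fun K : subgroup_space G => sub_mem K g).
  move=> K; apply: (@continuous_comp _ _ _ (fun K : subgroup_space G => val K)
    (fun f : {ptws G -> bool} => f g)).
    exact: val_continuous.
  exact: ptws_eval_continuous.
rewrite (_ : [set K | _] =
  (fun K : subgroup_space G => sub_mem K g) @^-1` [set b]) //.
by apply: open_comp => //; exact: discrete_open.
Qed.

Section hom.
Variables (G : groupType) (X : choiceType).
Implicit Types (s t : hom_space G X) (g h : G) (x : X).

Definition eval s (p : G * X) : X := action_of s p.1 p.2.

Lemma action1 s x : action_of s 1 x = x.
Proof. by have := valP s; rewrite inE => -[s1 _]; rewrite /action_of s1. Qed.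

Lemma actionM s g h x : action_of s (g * h) x = action_of s g (action_of s h x).
Proof. by have := valP s; rewrite inE => -[_ sM]; rewrite /action_of sM. Qed.

Lemma actionK s g : cancel (action_of s g) (action_of s g^-1).
Proof. by move=> x; rewrite -actionM mulVg action1. Qed.

Lemma actionVK s g : cancel (action_of s g^-1) (action_of s g).
Proof. by move=> x; rewrite -actionM mulgV action1. Qed.

Lemma nbhs_hom s (U : set (hom_space G X)) :
  nbhs s U -> exists D, agree eval s D `<=` U.
Proof.
suff H : filter_from setT (agree eval s) --> s by move=> /H[D _]; exists D.
have FF := agree_filter eval s.
(* Two layers of pointwise convergence: over [G], then over [X] for the permutation attached to
   [g]. *)
apply: set_type_cvg; apply: ptws_cvg => g.
apply: set_type_cvg; apply: ptws_cvg => x A /= /principal_filterP As.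
exists [:: (g, x)] => // t /(_ (g, x)); rewrite inE eqxx => /(_ isT) /= ts.
by rewrite /= -[val (val t g) x]/(eval t (g, x)) ts.
Qed.

Lemma eval_open p y : open [set s | eval s p = y].
Proof.
have c : continuous (fun s => eval s p : discrete_topology X).
  move=> s; apply: (@continuous_comp _ _ _ (fun s : hom_space G X => val s p.1)
    (fun f : perms X => val f p.2 : discrete_topology X)).
    apply: (@continuous_comp _ _ _ (fun s : hom_space G X => val s)
      (fun f : {ptws G -> perms X} => f p.1)).
      exact: val_continuous.
    exact: ptws_eval_continuous.
  apply: (@continuous_comp _ _ _ (fun s : perms X => val s)
      (fun f : {ptws X -> discrete_topology X} => f p.2)).
    exact: val_continuous.
  exact: ptws_eval_continuous.
rewrite (_ : [set s | _] =
  (fun s => eval s p : discrete_topology X) @^-1` [set y]) //.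
by apply: open_comp => //; exact: discrete_open.
Qed.

Lemma open_of_agree (U : set (hom_space G X)) :
  (forall s, U s -> exists D, agree eval s D `<=` U) -> open U.
Proof.
move=> UD; rewrite openE => s /UD[D DU]; apply: filterS DU _.
by apply: open_nbhs_nbhs; split; [apply: agree_open; exact: eval_open|].
Qed.

End hom.

End pointwise_convergence.

Local Open Scope fset_scope.

(** * Hall's marriage theorem for finite sets *)

Lemma cardfsUD (T : choiceType) (A B : {fset T}) :
  #|` A `|` B| = (#|` B| + #|` A `\` B|)%N.
Proof. by have := cardfsUI A B; have := cardfsID B A; lia. Qed.

Section hall.
Variables (T S : choiceType).
Implicit Types (A B C : {fset T}) (N : T -> {fset S}).

Definition neighbours N A : {fset S} := [fset y | x in A, y in N x].

Lemma neighboursP N A y :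
  reflect (exists2 x, x \in A & y \in N x) (y \in neighbours N A).
Proof.
apply: (iffP (imfset2P _ _ _ _ _)) => [[x xA [y' yN ->]]|[x xA yN]];
  by exists x => //; exists y.
Qed.

Lemma neighboursU N A B :
  neighbours N (A `|` B) = neighbours N A `|` neighbours N B.
Proof.
apply/fsetP => y; rewrite inE; apply/neighboursP/orP.
  move=> [x]; rewrite inE => /orP[] xA yx; [left|right];
  by apply/neighboursP; exists x.
by move=> [] /neighboursP[x xA yx]; exists x; rewrite // inE xA ?orbT.
Qed.

Lemma neighboursD N A (Z : {fset S}) :
  neighbours (fun x => N x `\` Z) A = neighbours N A `\` Z.
Proof.
apply/fsetP => y; rewrite inE; apply/neighboursP/andP.
  move=> [x xA]; rewrite inE => /andP[-> yx]; split=> //.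
  by apply/neighboursP; exists x.
by move=> [yZ /neighboursP[x xA yx]]; exists x; rewrite // inE yZ.
Qed.

Lemma neighbours1 N x : neighbours N [fset x] = N x.
Proof.
apply/fsetP => y; apply/neighboursP/idP => [[z]|yx].
  by rewrite inE => /eqP->.
by exists x; rewrite ?inE.
Qed.

(** Induction on the size of [A]. If no nonempty proper subset is tight for Hall's condition, some
    [a] is matched to any neighbour [b] and both are removed; otherwise a tight [B] is matched first
    and the rest of [A] is matched outside the neighbours of [B]. [d] supplies the function when [A]
    is empty. *)
Lemma hall_marriage (d : S) N A :
  (forall B, B `<=` A -> #|` B| <= #|` neighbours N B|)%N ->
  exists f : T -> S,
    {in A, forall x, f x \in N x} /\ {in A &, injective f}.
Proof.
have [n An] := ubnP #|` A|; elim: n => // n IH in N A An *.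
move=> hallA; have [->|[a aA]] := fset_0Vmem A.
  by exists (fun=> d); split=> ? //; rewrite inE.
have [[B [BA B0 BN]]|tight] := pselect (exists B,
    [/\ B `<` A, B != fset0 & #|` neighbours N B| <= #|` B|])%N; last first.
  have /fset0Pn[b bNa] : N a != fset0.
    rewrite -cardfs_gt0 -(neighbours1 N a).
    by rewrite (leq_trans _ (hallA _ _)) ?cardfs1 ?fsub1set.
  have [||f [fN finj]] := IH (fun x => N x `\` [fset b]) (A `\ a).
  - by move: An; rewrite (cardfsD1 a) aA.
  - move=> B BA; have [->|B0] := eqVneq B fset0; first by rewrite cardfs0.
    rewrite neighboursD -ltnS.
    (* In the absence of tight sets the inequality is strict, which pays for the loss of [b]. *)
    have BN : (#|` B| < #|` neighbours N B|)%N.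
      rewrite ltnNge; apply/negP => NB; apply: tight; exists B; split=> //.
      by apply: fsub_proper_trans BA _; rewrite fproperD1.
    apply: leq_trans BN _.
    by rewrite (cardfsD1 b (neighbours N B)); case: (b \in _).
  exists (fun x => if x == a then b else f x); split=> [x xA|x y xA yA].
    case: eqP => [->//|/eqP xa].
    by have := fN x; rewrite !inE xa xA => /(_ isT) /andP[].
  have f_b z : z \in A -> z != a -> f z != b.
    by move=> zA za; have := fN z; rewrite !inE za zA => /(_ isT) /andP[].
  case: (eqVneq x a) => [->|xa]; case: (eqVneq y a) => [->|ya] //.
  - by move=> bf; have := f_b y yA ya; rewrite -bf eqxx.
  - by move=> bf; have := f_b x xA xa; rewrite bf eqxx.
  - by apply: finj; rewrite !inE ?xa ?ya.
have BsubA := fproper_sub BA.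
have [||f [fN finj]] := IH N B.
- exact: leq_trans (fproper_ltn_card BA) _.
- by move=> C CB; apply: hallA; exact: fsubset_trans BsubA.
have [||h [hN hinj]] := IH (fun x => N x `\` neighbours N B) (A `\` B).
- have : (0 < #|` B|)%N by rewrite cardfs_gt0.
  by have := cardfsID B A; rewrite (fsetIidPr BsubA); lia.
- move=> C; rewrite fsubsetD => /andP[CA CB].
  rewrite neighboursD.
  (* Hall's condition for the union of [C] and [B], minus the tight count for [B], is the condition
     for [C] outside the neighbours of [B]. *)
  have := hallA (C `|` B); rewrite fsubUset CA BsubA => /(_ isT).
  rewrite neighboursU !cardfsUD (fsetDidPl _ _ CB); lia.
exists (fun x => if x \in B then f x else h x); split=> [x xA|x y xA yA].
  case: ifPn => [/fN//|xB].
  by have := hN x; rewrite !inE xA xB => /(_ isT) /andP[].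
have h_f u v : u \in B -> v \in A -> v \notin B -> f u <> h v.
  move=> uB vA vB fh; have := hN v; rewrite !inE vB vA -fh => /(_ isT) /andP[].
  by move=> /negP[]; apply/neighboursP; exists u => //; exact: fN.
case: ifPn => xB; case: ifPn => yB; first exact: finj.
- by move=> /(h_f _ _ xB yA yB).
- by move=> /esym /(h_f _ _ yB xA xB).
- by apply: hinj; rewrite inE ?xB ?yB.
Qed.

End hall.

(** * Matchings of infinite sets by ultrafilter limits *)

Section ultrafilters.
Local Open Scope classical_set_scope.

(** Pigeonhole for ultrafilters, which yields limits of maps with values in a finite set. *)
Lemma ultra_seq (T : Type) (I : eqType) (U : set_system T) (D : seq I)
    (A : I -> set T) : UltraFilter U ->
  U [set t | exists2 i, i \in D & A i t] -> exists2 i, i \in D & U (A i).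
Proof.
move=> UU; elim: D => [|i D IH] UD.
  by case: (@filter_ex _ U _ _ UD) => t [].
have [UA|UA] := in_ultra_setVsetC (A i) UU.
  by exists i; rewrite ?inE ?eqxx.
have [|j jD Uj] := IH; last by exists j; rewrite // inE jD orbT.
apply: filterS (filterI UD UA) => t [[j]].
by rewrite inE => /orP[/eqP->|jD] Aj Ai //; exists j.
Qed.

End ultrafilters.

Section expansion.
Local Open Scope fset_scope.
Variables (G : groupType) (X : choiceType) (s : hom_space G X) (Y : set X).
Implicit Types (W : seq G) (E : {fset X}).

Definition translates W E : {fset X} := [fset action_of s w y | y in E, w in W].

Lemma translatesP W E z :
  reflect (exists y w, [/\ y \in E, w \in W & z = action_of s w y])
          (z \in translates W E).
Proof.
apply: (iffP (imfset2P _ _ _ _ _)) => [[y yE [w wW ->]]|[y [w [yE wW ->]]]].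
  by exists y, w.
by exists y => //; exists w.
Qed.

(** Hall's theorem on two copies of [E], tagged by booleans, where each copy of a point is joined to
    its [W]-translates. *)
Lemma finite_matching W E :
  (forall B, B `<=` E -> 2 * #|` B| <= #|` translates W B|)%N ->
  exists M : X * bool -> G,
    (forall p, p.1 \in E -> M p \in W) /\
    (forall p q, p.1 \in E -> q.1 \in E ->
      action_of s (M p) p.1 = action_of s (M q) q.1 -> p = q).
Proof.
move=> WE; have [->|[d dE]] := fset_0Vmem E.
  by exists (fun=> 1%g); split=> p; rewrite inE.
pose pairs (F : {fset X}) : {fset X * bool} :=
  [fset (y, true) | y in F] `|` [fset (y, false) | y in F].
have pairsE F p : (p \in pairs F) = (p.1 \in F).
  rewrite /pairs in_fsetU; apply/orP/idP => [[]/imfsetP[y yF ->]//|].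
  by case: p => y [] /= yF; [left|right]; apply/imfsetP; exists y.
have pairs_card F : (#|` pairs F| <= 2 * #|` F|)%N.
  rewrite mul2n -addnn; apply: leq_trans (leq_card_fsetU _ _) _.
  by apply: leq_add; exact: leq_imfset_card.
pose A := pairs E.
pose N (p : X * bool) := [fset action_of s w p.1 | w in W].
have [B BA|f [fN finj]] := @hall_marriage _ _ d N A.
  (* Forgetting the tags keeps the neighbours and at most halves the cardinality. *)
  pose B1 := [fset p.1 | p in B].
  have B1E : B1 `<=` E.
    by apply/fsubsetP => _ /imfsetP[p pB ->]; rewrite -pairsE (fsubsetP BA).
  have -> : neighbours N B = translates W B1.
    apply/fsetP => z; apply/neighboursP/translatesP.
      move=> [p pB /imfsetP[w /= wW ->]]; exists p.1, w; split=> //.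
      by apply/imfsetP; exists p.
    move=> [_ [w [/imfsetP[/= p pB ->] wW ->]]]; exists p => //.
    by apply/imfsetP; exists w.
  apply: leq_trans (WE _ B1E).
  apply: leq_trans (pairs_card B1); apply: fsubset_leq_card.
  by apply/fsubsetP => p pB; rewrite pairsE; apply/imfsetP; exists p.
have /choice[M MP] : forall p : X * bool, exists w, p.1 \in E ->
    w \in W /\ f p = action_of s w p.1.
  move=> p; have [pE|_] := boolP (p.1 \in E); last by exists 1%g.
  by have := fN p; rewrite pairsE => /(_ pE) /imfsetP[w wW fw]; exists w.
exists M; split=> [p /MP[]//|p q pE qE].
by rewrite -(MP _ pE).2 -(MP _ qE).2; apply: finj; rewrite pairsE.
Qed.

(* The finite matchings use displacements in the finite set [W], so they have
   a limit along any ultrafilter of finite subsets of [X]. *)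
Lemma infinite_matching W :
  (forall B : {fset X}, ([set` B] `<=` Y)%classic ->
    (2 * #|` B| <= #|` translates W B|)%N) ->
  exists M : X * bool -> G,
    (forall p, Y p.1 -> M p \in W) /\
    (forall p q, Y p.1 -> Y q.1 ->
      action_of s (M p) p.1 = action_of s (M q) q.1 -> p = q).
Proof.
move=> WY.
have /choice[M MP] : forall E, exists M : X * bool -> G,
    (forall p, p.1 \in E -> Y p.1 -> M p \in W) /\
    (forall p q, p.1 \in E -> q.1 \in E -> Y p.1 -> Y q.1 ->
      action_of s (M p) p.1 = action_of s (M q) q.1 -> p = q).
  move=> E; pose EY := [fset y | y in E & `[<Y y>]].
  have EYP y : (y \in EY) = (y \in E) && `[<Y y>] by rewrite !inE.
  have [B|M [MW Minj]] := @finite_matching W EY.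
    move=> /fsubsetP BY; apply: WY => y /BY; rewrite EYP => /andP[_ /asboolP//].
  exists M; split=> [p pE Yp|p q pE qE Yp Yq].
    by apply: MW; rewrite EYP pE; apply/asboolP.
  by apply: Minj; rewrite EYP ?pE ?qE; apply/asboolP.
(* An ultrafilter above this filter contains, for every point of [X], the family of finite sets
   through that point. *)
have FF : ProperFilter (filter_from setT
    (fun D : {fset X} => [set E : {fset X} | (D `<=` E)%fset]%classic)).
  apply: filter_from_proper; last by move=> D _; exists D; exact: fsubset_refl.
  apply: filter_fromT_filter; first by exists fset0.
  move=> D1 D2; exists (D1 `|` D2) => E /=.
  by rewrite fsubUset => /andP[].
have [U [UU FU]] := ultraFilterLemma FF.
have Umem x : U [set E | x \in E]%classic.
  by apply: FU; exists [fset x] => // E /=; rewrite fsub1set.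
have /choice[N NP] : forall p, exists w, Y p.1 ->
    w \in W /\ U [set E | M E p = w]%classic.
  move=> p; have [Yp|nYp] := pselect (Y p.1); last by exists 1%g.
  have [|w wW Uw] := @ultra_seq _ _ U W
      (fun w => [set E | M E p = w]%classic) UU.
    apply: filterS (Umem p.1) => E pE /=.
    by exists (M E p) => //; exact: (MP E).1.
  by exists w.
exists N; split=> [p /NP[]//|p q Yp Yq Npq].
(* Injectivity concerns two points at a time, so it is inherited from a single [E] that contains
   both and for which [M E] agrees with [N] at [p] and [q]. *)
have [_ Up] := NP _ Yp; have [_ Uq] := NP _ Yq.
have [E [[Ep Eq] [pE qE]]] :=
  filter_ex (filterI (filterI Up Uq) (filterI (Umem p.1) (Umem q.1))).
by apply: ((MP E).2 p q) => //; rewrite Ep Eq.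
Qed.

End expansion.

(** * Amenability implies the Folner condition *)

Section folner.
Local Open Scope classical_set_scope.
Local Open Scope group_scope.
Variables (R : realType) (G : groupType) (X : choiceType) (s : hom_space G X).
Implicit Types (A B Y : set X) (E : {fset X}).

Section mean.
Variables (m : set X -> R) (Y : set X).
Hypotheses (mD : forall A B, A `<=` Y -> B `<=` Y -> A `&` B = set0 ->
              m (A `|` B) = (m A + m B)%R)
           (mG : forall g A, A `<=` Y -> m (action_of s g @` A) = m A)
           (YG : forall g y, Y y -> Y (action_of s g y)).

(** Induction on [W]: the points displaced by [w] are split off and translated as one piece.
    Injectivity keeps the images of the two pieces disjoint. *)
Lemma mean_piecewise_translate (W : seq G) (a : X -> G) A : A `<=` Y ->
    (forall y, A y -> a y \in W) ->
    {in A &, injective (fun y => action_of s (a y) y)} ->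
  m ((fun y => action_of s (a y) y) @` A) = m A.
Proof.
elim: W A => [|w W IH] A AY AW ainj.
  rewrite (_ : A = set0) ?image_set0 //.
  by apply/seteqP; split=> // y /AW.
pose A1 := A `&` [set y | a y = w]; pose A2 := A `&` [set y | a y <> w].
have AE : A = A1 `|` A2.
  by rewrite -setIUr [X in _ `&` X]setUCr setIT.
have A1Y : A1 `<=` Y by move=> y [/AY].
have A2Y : A2 `<=` Y by move=> y [/AY].
have subY B : B `<=` Y -> (fun y => action_of s (a y) y) @` B `<=` Y.
  by move=> BY _ [y /BY Yy <-]; exact: YG.
rewrite {1}AE image_setU mD; [|exact: subY|exact: subY|]; last first.
  apply/seteqP; split=> // z [[y [Ay ay] <-] [t [At nt] /ainj yt]].
  by apply: nt; rewrite yt ?inE.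
rewrite (IH A2) //.
- rewrite (_ : _ @` A1 = action_of s w @` A1) ?mG//.
    rewrite -mD -?AE //; apply/seteqP; split=> // y [[_ yw] [_ nyw]].
    exact: nyw.
  by apply/seteqP; split=> _ [y [Ay ay] <-]; exists y; rewrite ?ay.
- by move=> y [Ay /eqP nw]; have := AW y Ay; rewrite inE (negPf nw).
- by move=> y z; rewrite !inE => -[Ay _] [Az _]; apply: ainj; rewrite inE.
Qed.

End mean.

(* Hall's theorem yields two disjoint piecewise translates of [Y] inside [Y],
   and both have measure 1. *)
Lemma amenable_not_expanding (W : seq G) Y :
    (forall g y, Y y -> Y (action_of s g y)) ->
    amenable R (action_of s) Y ->
  ~ (forall B : {fset X}, [set` B] `<=` Y ->
      (2 * #|` B| <= #|` translates s W B|)%N).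
Proof.
move=> YG [m [mY m0 mD mG]] /infinite_matching[M [MW Minj]].
pose T b := (fun y => action_of s (M (y, b)) y) @` Y.
have mT b : m (T b) = 1%R.
  rewrite /T (mean_piecewise_translate mD mG YG (W := W)) //.
    by move=> y Yy; exact: MW.
  by move=> y z; rewrite !inE => Yy Yz /(Minj (y, b) (z, b) Yy Yz) [].
have TY b : T b `<=` Y by move=> _ [y Yy <-]; exact: YG.
have T0 : T true `&` T false = set0.
  apply/seteqP; split=> // z [[y Yy <-] [t Yt]].
  by move=> /(Minj (t, false) (y, true) Yt Yy) [].
have UY : T true `|` T false `<=` Y by move=> z [] /TY.
have DY : Y `\` (T true `|` T false) `<=` Y by exact: subDsetl.
(* [Y] would have measure [1 + 1] plus a nonnegative remainder. *)
have := mD _ _ UY DY (setDIK _ _); rewrite setDUK // mY mD // !mT => /eqP.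
by rewrite lt_eqF // ltr_wpDr ?m0 // ltrDl ltr01.
Qed.

(** The precision is [1/n], stated without division. As translation preserves cardinality, the part
    of a translate outside [E] has half the size of the symmetric difference. *)
Definition folner Y (W : seq G) (n : nat) : Prop :=
  exists E, [/\ E != fset0, [set` E] `<=` Y &
    forall g, g \in W ->
      (n * #|` [fset action_of s g y | y in E] `\` E|%fset <= #|` E|)%N].

(** Since [1] is among the letters, these are the products of at most [k] elements of [W]. *)
Fixpoint words (W : seq G) (k : nat) : seq G :=
  if k is k'.+1 then [seq w * v | w <- 1 :: W, v <- words W k'] else [:: 1].

Lemma translates_words W k E :
  translates s (words W k.+1) E =
  translates s (1%g :: W) (translates s (words W k) E).
Proof.
apply/fsetP => z; apply/translatesP/translatesP.
  move=> [y [_ [yE /allpairsP[[w v] /= [wW vW ->]] ->]]].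
  exists (action_of s v y), w; split=> //; last exact: actionM.
  by apply/translatesP; exists y, v.
move=> [_ [w [/translatesP[y [v [yE vW ->]]] wW ->]]].
exists y, (w * v); split=> //; last by rewrite actionM.
by apply/allpairsP; exists (w, v).
Qed.

(** The first two terms of the binomial expansion of [(n + 1)^n] both equal [n^n]. *)
Lemma bernoulli n : (0 < n)%N -> (2 * n ^ n <= n.+1 ^ n)%N.
Proof.
move=> n0; case: n n0 => // n _; rewrite -[n.+2]addn1 expnDn.
rewrite big_ord_recl big_ord_recl /=.
rewrite /bump /= !subn0 bin0 bin1 !mul1n !exp1n !muln1 subSS subn0 expnS.
by rewrite mul2n -addnn addnA leq_addr.
Qed.

(* Without a Folner set, translating by [1 :: W] multiplies cardinals by at
   least [1 + 1/n], and [(1 + 1/n)^n >= 2]. *)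
Lemma expanding_of_not_folner Y W n :
    (forall g y, Y y -> Y (action_of s g y)) -> ~ folner Y W n ->
  forall E, [set` E] `<=` Y ->
    (2 * #|` E| <= #|` translates s (words W n) E|)%N.
Proof.
move=> YG nF.
have transY V E : [set` E] `<=` Y -> [set` translates s V E] `<=` Y.
  by move=> EY _ /translatesP[y [w [yE _ ->]]]; apply: YG; exact: EY.
(* At [n = 0] the cardinality condition is void, so [Y] contains no nonempty finite set. *)
have [n0|n0] := posnP n.
  move=> E EY; have [->|[y yE]] := fset_0Vmem E; first by rewrite cardfs0.
  case: nF; exists E; split=> //; last by move=> g _; rewrite n0 mul0n.
  by apply/fset0Pn; exists y.
have step E : [set` E] `<=` Y ->
    (n.+1 * #|` E| <= n * #|` translates s (1%g :: W) E|)%N.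
  move=> EY; have [->|[y yE]] := fset_0Vmem E; first by rewrite cardfs0 muln0.
  have [g gW ngE] : exists2 g, g \in W &
      (#|` E| < n * #|` [fset action_of s g y | y in E] `\` E|)%N%fset.
    apply: contrapT => ngW; apply: nF; exists E; split=> //.
      by apply/fset0Pn; exists y.
    by move=> g gW; rewrite leqNgt; apply/negP => ?; apply: ngW; exists g.
  have : ([fset action_of s g y | y in E] `|` E `<=`
      translates s (1%g :: W) E)%fset.
    apply/fsubsetP => z; rewrite in_fsetU.
    move=> /orP[/imfsetP[t tE ->]|zE]; apply/translatesP.
      by exists t, g; rewrite inE gW orbT.
    by exists z, 1; rewrite inE eqxx action1.
  move=> /fsubset_leq_card; rewrite cardfsUD; nia.
have iter E k : [set` E] `<=` Y ->
    (n.+1 ^ k * #|` E| <= n ^ k * #|` translates s (words W k) E|)%N.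
  move=> EY; elim: k => [|k IH].
    rewrite !mul1n; apply: fsubset_leq_card; apply/fsubsetP => y yE.
    by apply/translatesP; exists y, 1; rewrite inE eqxx action1.
  rewrite translates_words !expnSr.
  have := step _ (transY (words W k) E EY).
  move: IH; set a := (_ ^ k)%N; set b := (_ ^ k)%N; nia.
move=> E EY; have := iter E n EY; have := bernoulli n0.
have : (0 < n ^ n)%N by rewrite expn_gt0 n0.
set a := (n ^ n)%N; set b := (_ ^ n)%N; nia.
Qed.

Lemma amenable_folner Y W n : (forall g y, Y y -> Y (action_of s g y)) ->
  amenable R (action_of s) Y -> folner Y W n.
Proof.
move=> YG aY; apply: contrapT => /(expanding_of_not_folner YG).
exact: amenable_not_expanding.
Qed.

End folner.

(** * Invariant means as ultrafilter limits of Folner densities *)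

Lemma ultra_fmap (S T : Type) (f : S -> T) (U : set_system S) :
  UltraFilter U -> UltraFilter (f @ U)%classic.
Proof.
move=> UU; split=> [|F FF sUF]; first exact: fmap_proper_filter.
apply/seteqP; split=> // A FA.
have [//|UnA] := in_ultra_setVsetC (f @^-1` A)%classic UU.
have /sUF FnA : (f @ U)%classic (~` A)%classic by [].
by have [t []] := filter_ex (filterI FA FnA).
Qed.

Section folner_mean.
Local Open Scope classical_set_scope.
Local Open Scope group_scope.
Local Open Scope ring_scope.
Variables (R : realType) (G : groupType) (X : choiceType) (s : hom_space G X).
Implicit Types (A B Y : set X) (E : {fset X}).

Definition trace A E : {fset X} := [fset y in E | `[<A y>]]%fset.

Lemma in_trace A E y : (y \in trace A E) = (y \in E) && `[<A y>].
Proof. by rewrite /trace !inE. Qed.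

(** Translation by [g^-1] injects the trace of the translate into [A]; the image of a point either
    lies in [E], hence in the trace of [A], or is one of the points of the translate of [E] outside
    [E]. *)
Lemma trace_translate g A E :
  (#|` trace (action_of s g @` A) E| <= #|` trace A E| +
    #|` [fset action_of s g^-1%g y | y in E] `\` E|%fset)%N.
Proof.
have <- : #|` [fset action_of s g^-1%g y
                | y in trace (action_of s g @` A) E]%fset| =
    #|` trace (action_of s g @` A) E|.
  by rewrite card_imfset //; exact: can_inj (actionK s g^-1%g).
apply: leq_trans (leq_card_fsetU _ _); apply: fsubset_leq_card.
apply/fsubsetP => _ /imfsetP[z /= + ->].
rewrite in_trace => /andP[zE /asboolP[y Ay gyz]].
rewrite in_fsetU in_trace in_fsetD -gyz actionK.
case: (boolP (y \in E)) => yE /=; first by rewrite orbF; apply/asboolP.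
by apply/imfsetP; exists z => //; rewrite -gyz actionK.
Qed.

Definition density A E : R := #|` trace A E|%:R / #|` E|%:R.

Lemma density_ge0 A E : 0 <= density A E.
Proof. by rewrite divr_ge0. Qed.

Lemma density_le1 A E : density A E <= 1.
Proof.
have [->|E0] := eqVneq E fset0; first by rewrite /density cardfs0 invr0 mulr0.
rewrite ler_pdivrMr ?ltr0n ?cardfs_gt0 // mul1r ler_nat.
by apply: fsubset_leq_card; apply/fsubsetP => y; rewrite in_trace => /andP[].
Qed.

Lemma densityU A B E : A `&` B = set0 ->
  density (A `|` B) E = density A E + density B E.
Proof.
move=> AB; rewrite /density -mulrDl -natrD; congr (_%:R / _).
rewrite -cardfsUI (_ : (_ `&` _)%fset = fset0).
  rewrite cardfs0 addn0; congr #|` _|; apply/fsetP => y.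
  by rewrite in_fsetU !in_trace -andb_orr asbool_or.
apply/fsetP => y; rewrite in_fsetI !in_trace inE.
apply/negP => /andP[/andP[_ /asboolP Ay] /andP[_ /asboolP By]].
by have : (A `&` B) y by []; rewrite AB.
Qed.

Lemma folner_amenable Y :
  (forall W n, folner s Y W n) -> amenable R (action_of s) Y.
Proof.
move=> FY.
(* These families form a filter base: joining the lists and taking the larger precision index
   refines two conditions at once. *)
pose F (p : seq G * nat) := [set E : {fset X} |
  [/\ E != fset0, [set` E] `<=` Y &
    forall g, g \in p.1 ->
      (p.2 * #|` [fset action_of s g y | y in E] `\` E|%fset <= #|` E|)%N]].
have FF : ProperFilter (filter_from setT F).
  apply: filter_from_proper; last by move=> [W n] _; exact: FY.
  apply: filter_fromT_filter; first by exists ([::], 0%N).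
  move=> [W1 n1] [W2 n2]; exists (W1 ++ W2, maxn n1 n2) => E [E0 EY gE].
  split; split=> // g gW; apply: leq_trans (gE g _) => /=;
    by rewrite ?mem_cat ?gW ?orbT // leq_mul2r ?leq_maxl ?leq_maxr orbT.
have [U [UU FU]] := ultraFilterLemma FF.
have UF p : U (F p) by apply: FU; exists p.
pose m A : R := lim (density A @ U).
(* Densities lie in the compact interval [0, 1], so they converge along the ultrafilter. *)
have dm A : density A @ U --> m A.
  have := @segment_compact R 0 1; rewrite compact_ultra.
  move=> /(_ _ (ultra_fmap (density A) UU)) [].
    suff : U (density A @^-1` [set` `[0, 1]]) by [].
    apply: filterE => E /=.
    by rewrite in_itv /= density_ge0 density_le1.
  by move=> l [_ dl]; apply/cvg_ex; exists l.
have mlim A l : density A @ U --> l -> m A = l by apply: cvg_lim.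
exists m; split.
- apply: mlim; apply: cvg_near_cst.
  apply: filterS (UF ([::], 0%N)) => E [E0 EY _].
  rewrite /density (_ : trace Y E = E) ?divff ?pnatr_eq0 ?cardfs_eq0 //.
  apply/fsetP => y; rewrite in_trace; case: (boolP (y \in E)) => //= yE.
  by apply/asboolP; exact: EY.
- move=> A _; apply: limr_ge; first by apply/cvg_ex; exists (m A); exact: dm.
  by apply: filterE => E; exact: density_ge0.
- move=> A B _ _ AB; apply: mlim.
  rewrite (_ : density _ = (fun E => density A E + density B E)).
    exact: cvgD.
  by apply/funext => E; exact: densityU.
(* One inequality is enough, as it also applies to [g^-1]. A gap would exceed some [1/(k+1)], while
   Folner sets of precision [k.+1] for [g^-1] bound the difference of densities by that amount. *)
- have mG g A : m (action_of s g @` A) <= m A.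
    rewrite leNgt; apply/negP => /ltr_add_invr[k]; apply/negP; rewrite -leNgt.
    rewrite -lerBlDl.
    have mdiff : (fun E => density (action_of s g @` A) E - density A E) @ U -->
        m (action_of s g @` A) - m A by apply: cvgB.
    rewrite -(cvg_lim _ mdiff) //; apply: limr_le.
      by apply/cvg_ex; exists (m (action_of s g @` A) - m A).
    apply: filterS (UF ([:: g^-1%g], k.+1)) => E [E0 _ /(_ g^-1%g)] /=.
    rewrite inE eqxx => /(_ isT) kE.
    have Epos : 0 < #|` E|%:R :> R by rewrite ltr0n cardfs_gt0.
    rewrite /density -mulrBl ler_pdivrMr // mulrC ler_pdivlMr // mulrC.
    move: kE; rewrite -(ler_nat R) natrM; apply: le_trans.
    by rewrite ler_pM2l // lerBlDl -natrD ler_nat; exact: trace_translate.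
  move=> g A _; apply/eqP; rewrite eq_le mG /=.
  rewrite (_ : m A = m (action_of s g^-1%g @` (action_of s g @` A))) //.
  congr m; rewrite image_comp; apply/seteqP; split=> y /=.
    by move=> Ay; exists y; rewrite //= actionK.
  by move=> [z Az <-]; rewrite /= actionK.
Qed.

End folner_mean.

(** * Transfer of amenability along equivariant injections *)

Section transfer.
Local Open Scope classical_set_scope.
Variables (R : realType) (G : groupType) (T T' : Type).
Variables (act : G -> T -> T) (act' : G -> T' -> T') (Y : set T) (f : T -> T').
Hypotheses (YG : forall g y, Y y -> Y (act g y))
  (f_inj : {in Y &, injective f})
  (f_act : forall g y, Y y -> f (act g y) = act' g (f y)).

(** A mean on [Y] is pushed forward and one on the image is pulled back. Preimages are cut down to
    [Y] because [m] is constrained only on subsets of [Y]. *)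
Lemma amenable_image : amenable R act Y <-> amenable R act' (f @` Y).
Proof.
have finj y z : Y y -> Y z -> f y = f z -> y = z.
  by move=> Yy Yz; apply: f_inj; rewrite inE.
split=> -[m [mY m0 mD mG]].
  exists (fun A => m (Y `&` f @^-1` A)); split.
  - by rewrite (_ : Y `&` _ = Y) //; apply/setIidPl => y Yy; exists y.
  - by move=> A _; apply: m0.
  - move=> A B _ _ AB; rewrite preimage_setU setIUr mD //.
    apply/seteqP; split=> // y [[_ Ay] [_ By]].
    by have : (A `&` B) (f y) by []; rewrite AB.
  - move=> g A AY; rewrite -(mG g (Y `&` f @^-1` A)) //; congr m.
    apply/seteqP; split=> [y [Yy]|].
      move=> [a Aa ga]; have [z Yz za] := AY _ Aa; exists z.
        by split=> //; rewrite /preimage /= za.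
      by apply: finj => //; [exact: YG|rewrite f_act // za].
    move=> _ [y [Yy Ay] <-]; split; first exact: YG.
    by exists (f y); rewrite // f_act.
exists (fun A => m (f @` A)); split=> //.
- by move=> A AY; apply: m0; exact: image_subset.
- move=> A B AY BY AB; rewrite image_setU mD //; try exact: image_subset.
  apply/seteqP; split=> // _ [[y Ay <-] [z Bz /finj zy]].
  have : (A `&` B) y by split=> //; rewrite -zy //; [exact: BY|exact: AY].
  by rewrite AB.
- move=> g A AY; rewrite -(mG g (f @` A)); last exact: image_subset.
  congr m; rewrite !image_comp; apply: eq_imagel => y /AY Yy.
  by rewrite /= f_act.
Qed.

End transfer.

(** * Stabilizers, cosets and orbits *)

Section stabilizer.
Local Open Scope classical_set_scope.
Local Open Scope group_scope.
Variables (G : groupType).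
Implicit Types (K : subgroup_space G) (g h : G).

Lemma sub_mem1 K : sub_mem K 1.
Proof. by have := valP K; rewrite inE => -[K1 _]; exact: K1. Qed.

Lemma sub_mem_div K g h : sub_mem K g -> sub_mem K h -> sub_mem K (g / h).
Proof. by have := valP K; rewrite inE => -[_ KV]; exact: KV. Qed.

Lemma sub_memV K g : sub_mem K g -> sub_mem K g^-1.
Proof.
by move=> Kg; rewrite -[g^-1]mul1g; apply: sub_mem_div => //; exact: sub_mem1.
Qed.

Lemma sub_memM K g h : sub_mem K g -> sub_mem K h -> sub_mem K (g * h).
Proof.
by move=> Kg Kh; rewrite -[h]invgK; apply: sub_mem_div => //; exact: sub_memV.
Qed.

Lemma sub_mem_inj K L : sub_mem K =1 sub_mem L -> K = L.
Proof. by move=> KL; apply: val_inj; apply/funext => g; exact: KL. Qed.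

Definition coset K g : set G := [set g * k | k in [set k | val K k]].

Lemma cosetP K g h : coset K g h <-> sub_mem K (g^-1 * h).
Proof.
by split=> [[k Kk <-]|Kgh]; [rewrite mulKg|exists (g^-1 * h); rewrite ?mulVKg].
Qed.

Lemma coset_eq K g h : coset K g = coset K h <-> sub_mem K (g^-1 * h).
Proof.
split=> [gh|Kgh].
  by apply/cosetP; rewrite gh; apply/cosetP; rewrite mulVg; exact: sub_mem1.
apply/seteqP; split=> u /cosetP Ku; apply/cosetP.
  have -> : h^-1 * u = (g^-1 * h)^-1 * (g^-1 * u).
    by rewrite invgM invgK -mulgA mulVKg.
  by apply: sub_memM => //; exact: sub_memV.
have -> : g^-1 * u = (g^-1 * h) * (h^-1 * u) by rewrite -mulgA mulVKg.
exact: sub_memM.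
Qed.

Lemma coset_translate K g h : [set g * c | c in coset K h] = coset K (g * h).
Proof.
by rewrite /coset image_comp; apply: eq_imagel => k _; rewrite /= mulgA.
Qed.

Variables (X : choiceType).
Implicit Types (s : hom_space G X) (x y : X).

Lemma stab_subproof s x :
  (fun g => `[< action_of s g x = x >]) \in
    [set K : {ptws G -> bool} | group_closed K].
Proof.
rewrite inE; split=> [|g h]; rewrite -!topredE /=.
  by apply/asboolP; rewrite action1.
move=> /asboolP sg /asboolP sh; apply/asboolP.
by rewrite actionM -{1}sh actionK.
Qed.

Definition stab s x : subgroup_space G :=
  exist (fun K : {ptws G -> bool} => K \in [set K | group_closed K]) _
    (stab_subproof s x).

Lemma stabP s x g : reflect (action_of s g x = x) (sub_mem (stab s x) g).
Proof. exact: asboolP. Qed.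

Lemma coset_stab s x g h :
  coset (stab s x) g h <-> action_of s h x = action_of s g x.
Proof.
split=> [/cosetP/stabP|hg]; first by rewrite actionM => {2}<-; rewrite actionVK.
by apply/cosetP/stabP; rewrite actionM hg actionK.
Qed.

Lemma orbit_of_stable s x g y :
  orbit_of s x y -> orbit_of s x (action_of s g y).
Proof. by move=> [h _ <-]; exists (g * h); rewrite // actionM. Qed.

(** Orbit-stabilizer bijection: a point [y] of the orbit corresponds to the set of all [g] taking
    [x] to [y], which is a left coset of the stabilizer. *)
Lemma orbit_amenable (R : realType) s x :
  amenable R (action_of s) (orbit_of s x) <-> coamenable R (stab s x).
Proof.
pose f y : set G := [set g | action_of s g x = y].
have fE g : f (action_of s g x) = coset (stab s x) g.
  by apply/seteqP; split=> h /coset_stab.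
rewrite /coamenable (_ : left_cosets _ = f @` orbit_of s x).
  apply: amenable_image.
  - by move=> g y; exact: orbit_of_stable.
  - move=> y z; rewrite !inE => -[g _ <-] [h _ <-] gh.
    by have : f (action_of s h x) g by rewrite -gh.
  - by move=> g _ [h _ <-]; rewrite -actionM !fE coset_translate.
rewrite /orbit_of image_comp; apply: eq_imagel => g _.
by rewrite /= fE.
Qed.

End stabilizer.

(** * Construction of actions on X by gluing *)

Section extension.
Local Open Scope classical_set_scope.

Lemma countableU (T : Type) (A B : set T) :
  countable A -> countable B -> countable (A `|` B).
Proof.
by move=> cA cB; rewrite -bigcup2E; apply: bigcup_countable => // -[|[]].
Qed.

Lemma countable_image (T U : Type) (f : T -> U) (A : set T) :
  countable A -> countable (f @` A).
Proof. by apply: sub_countable; exact: card_image_le. Qed.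

(** The complement of [D] and the complement of its image in [Y] are both countably infinite, so any
    bijection between them completes [phi]. *)
Lemma extend_bijection (X : eqType) (T : Type) (Y : set T) (D : seq X)
    (phi : X -> T) :
    ([set: X] #= [set: nat])%card -> countable Y -> infinite_set Y ->
    (forall x, x \in D -> Y (phi x)) -> {in D &, injective phi} ->
  exists f : X -> T, [/\ injective f, range f = Y & {in D, f =1 phi}].
Proof.
move=> cX cY iY phiY phi_inj.
(* An empty [T] contradicts the infinitude of [Y]; otherwise [T] has a base point. *)
elim/Ppointed: T => T in Y phi cY iY phiY phi_inj *.
  by have := infinite_setN0 iY; rewrite emptyE => -[].
have cXD : ([set: X] `\` [set` D] #= [set: nat])%card.
  apply: eq_card_nat; first apply: (@sub_countable _ _ _ [set: X]).
    exact: subset_card_le.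
  by rewrite (eq_countable cX).
  apply: infinite_setD; last exact: finite_seq.
  by rewrite (eq_finite_set cX); exact: infinite_nat.
have cYD : (Y `\` phi @` [set` D] #= [set: nat])%card.
  apply: eq_card_nat.
    by apply: sub_countable cY; apply: subset_card_le; exact: subDsetl.
  apply: infinite_setD => //; apply: finite_image; exact: finite_seq.
have /card_set_bijP[b [bfun binj bsurj]] :=
  card_eq_trans cXD (card_esym cYD).
exists (fun x => if x \in D then phi x else b x).
have bD x : x \notin D -> Y (b x) /\ ~ (phi @` [set` D]) (b x).
  by move=> xD; apply: bfun; split=> //; apply/negP.
split; last by move=> x ->.
- move=> x y; case: ifPn => xD; case: ifPn => yD.
  + exact: phi_inj.
  + by move=> xy; have [_ []] := bD y yD; exists x.
  + by move=> xy; have [_ []] := bD x xD; exists y.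
  + by apply: binj; rewrite inE; split=> //; apply/negP.
- apply/seteqP; split=> [_ [x _ <-]|u Yu].
    by case: ifPn => [/phiY//|/bD[]].
  have [[x /= xD <-]|nu] := pselect ((phi @` [set` D]) u).
    by exists x => //; rewrite xD.
  have [x [_ /negP xD] <-] := bsurj u (conj Yu nu).
  by exists x => //; rewrite (negPf xD).
Qed.

End extension.

Section surgery.
Local Open Scope classical_set_scope.
Local Open Scope group_scope.
Variables (G : groupType) (X : choiceType).

Lemma hom_of_action (a : G -> X -> X) :
    (forall x, a 1 x = x) -> (forall g h x, a (g * h) x = a g (a h x)) ->
  exists s : hom_space G X, forall g x, action_of s g x = a g x.
Proof.
move=> a1 aM.
have bij g : bijective (a g).
  by exists (a g^-1) => x; rewrite -aM ?mulVg ?mulgV a1.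
pose p : {ptws G -> perms X} := fun g => mk_perm (bij g).
have pM : p \in [set s : {ptws G -> perms X} | monoid.monoid_morphism s].
  rewrite inE; split=> [|g h]; apply: perm_fun_inj; apply/funext => x.
    exact: a1.
  exact: aM.
by exists (exist _ p pM).
Qed.

Variables (K : subgroup_space G) (s0 : hom_space G X).

(* The disjoint union of [G / K] and of [X] acted upon by [s0]. *)
Definition glue g (u : set G + X) : set G + X :=
  match u with
  | inl C => inl [set g * c | c in C]
  | inr y => inr (action_of s0 g y)
  end.

Definition glue_set : set (set G + X) :=
  [set u | if u is inl C then left_cosets K C else True].

Lemma glue1 u : glue 1 u = u.
Proof.
case: u => [C|y] /=; last by rewrite action1.
by congr inl; rewrite (eq_imagel (f' := id)) ?image_id // => c _; rewrite mul1g.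
Qed.

Lemma glueM g h u : glue (g * h) u = glue g (glue h u).
Proof.
case: u => [C|y] /=; last by rewrite actionM.
by congr inl; rewrite image_comp; apply: eq_imagel => c _; rewrite /= mulgA.
Qed.

Lemma glue_stable g u : glue_set u -> glue_set (glue g u).
Proof.
case: u => [C|y] //= [h _ <-].
by exists (g * h); rewrite // coset_translate.
Qed.

(** The union is countably infinite, so [phi] on [D] extends to a bijection [f] from [X] onto it,
    along which the glued action is transported back. *)
Lemma surgery (D : seq X) (phi : X -> set G + X) :
    countable [set: G] -> ([set: X] #= [set: nat])%card ->
    (forall x, x \in D -> glue_set (phi x)) -> {in D &, injective phi} ->
  exists (s : hom_space G X) (f : X -> set G + X),
    [/\ injective f, {in D, f =1 phi} &
        forall g x, f (action_of s g x) = glue g (f x)].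
Proof.
move=> cG cX phiY phi_inj.
have glueE : glue_set = inl @` left_cosets K `|` inr @` [set: X].
  apply/seteqP; split=> [[C CK|y _]|_ [[C CK <-]|[y _ <-]]] //=.
    by left; exists C.
  by right; exists y.
have countX : countable [set: X] by rewrite (eq_countable cX).
have [|||||f [finj fY fphi]] := @extend_bijection X _ glue_set D phi.
- exact: cX.
- rewrite glueE; apply: countableU; apply: countable_image => //.
  exact: countable_image.
- rewrite glueE => /(sub_finite_set (@subsetUr _ _ _)).
  rewrite (eq_finite_set (inj_card_eq _)).
    by rewrite (eq_finite_set cX); exact: infinite_nat.
  by move=> x y _ _ [].
- exact: phiY.
- exact: phi_inj.
have /choice[a aE] : forall p : G * X, exists y, f y = glue p.1 (f p.2).
  move=> [g x]; have : glue_set (glue g (f x)).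
    by apply: glue_stable; rewrite -fY; exists x.
  by rewrite -fY => -[y _ fy]; exists y.
have [|g h x|s sa] := hom_of_action (a := fun g x => a (g, x)).
- by move=> x; apply: finj; rewrite /= aE glue1.
- by apply: finj; rewrite !aE /= glueM.
by exists s, f; split=> // g x; rewrite sa aE.
Qed.

End surgery.

(** * Baire category in Hom(G, X!) *)

Section baire.
Local Open Scope classical_set_scope.
Local Open Scope group_scope.

Lemma countable_enum (T : Type) (t0 : T) : countable [set: T] ->
  exists e : nat -> T, forall t, exists n, e n = t.
Proof.
move=> /countable_injP[f finj].
have /choice[e eP] : forall n, exists t, forall t', f t' = n -> t = t'.
  move=> n; have [[t ft]|nt] := pselect (exists t, f t = n).
    by exists t => t' ft'; apply: finj; rewrite ?inE // ft.
  by exists t0 => t' ft'; case: nt; exists t'.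
by exists e => t; exists (f t); exact: eP.
Qed.

Variables (G : groupType) (X : choiceType).
Hypotheses (cG : countable [set: G]) (cX : countable [set: X]).

(* A pointwise limit of actions is an action: it takes its values in the
   bijections because the action of [g^-1] also converges. *)
Lemma hom_baire (U : nat -> set (hom_space G X)) (s : hom_space G X)
    (D : seq (G * X)) :
  (forall n, open (U n) /\ dense (U n)) ->
  exists2 t, agree (@eval G X) s D t & forall n, U n t.
Proof.
(* If [X] is empty, Hom(G, X!) is a single point. *)
move=> Uod; have [x0|X0] := pselect (exists x : X, True); last first.
  have X_subsing (t : hom_space G X) : s = t.
    apply: val_inj; apply/funext => g; apply: perm_fun_inj; apply/funext => x.
    by case: X0; exists x.
  exists s => // n; have [|t [_ Ut]] := (Uod n).2 setT _ openT.
    by exists s.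
  by rewrite (X_subsing t).
have [x _] := x0.
have [|e eP] := countable_enum (1%g : G, x).
  by rewrite -setXTT; exact: countableX.
have /choice[N NP] := eP.
(* A stage is an action with a finite set of frozen values; step [n] enters [U n] for good and
   freezes the value at the pair [e n]. *)
have /choice[step stepP] : forall q : nat * (hom_space G X * seq (G * X)),
    exists r : hom_space G X * seq (G * X),
    [/\ agree (@eval G X) q.2.1 q.2.2 r.1, {subset q.2.2 <= r.2},
        e q.1 \in r.2 &
        agree (@eval G X) r.1 r.2 `<=` U q.1].
  move=> [n [s1 D1]] /=.
  have [t [st Ut]] := (Uod n).2 (agree (@eval G X) s1 D1)
    (ex_intro _ s1 (fun _ _ => erefl)) (agree_open _ _ (@eval_open G X)).
  have [D2 D2U] := nbhs_hom (open_nbhs_nbhs (conj (Uod n).1 Ut)).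
  exists (t, e n :: D1 ++ D2); split=> //=.
  - by move=> p pD; rewrite inE mem_cat pD orbT.
  - by rewrite inE eqxx.
  - by move=> v vt; apply: D2U => p pD; apply: vt; rewrite inE mem_cat pD !orbT.
pose S := fix S n := if n is n'.+1 then step (n', S n') else (s, D).
have SS m n : (m <= n)%N ->
    agree (@eval G X) (S m).1 (S m).2 (S n).1 /\ {subset (S m).2 <= (S n).2}.
  elim: n => [|n IH]; first by rewrite leqn0 => /eqP->; split=> ? ?.
  rewrite leq_eqVlt => /orP[/eqP->|/IH[mn Dmn]]; first by split=> ? ?.
  have [a1 d1 _ _] := stepP (n, S n); split=> [p pD|p /Dmn/d1//].
  by rewrite -(mn p pD); apply: a1; exact: Dmn.
have NS p : p \in (S (N p).+1).2.
  by have [_ _] := stepP (N p, S (N p)); rewrite /= NP.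
(* The limit: the value at [p] no longer changes after the stage that freezes [p]. *)
pose a p := eval (S (N p).+1).1 p.
have aE p n : (N p < n)%N -> eval (S n).1 p = a p.
  by move=> /SS[/(_ p (NS p))].
have [x1|g h x1|t ta] := hom_of_action (a := fun g x => a (g, x)).
- by rewrite /a /eval action1.
(* At stage [n] all three values in the multiplicativity identity are frozen. *)
- set p1 := (g * h, x1); set p2 := (h, x1); set p3 := (g, a p2).
  pose n := (maxn (N p1) (maxn (N p2) (N p3))).+1.
  rewrite -(aE p1 n); last by rewrite ltnS leq_maxl.
  rewrite -(aE p3 n); last by rewrite ltnS !leq_max leqnn !orbT.
  rewrite /eval /= actionM -[action_of _ h x1]/(eval (S n).1 p2) aE //.
  by rewrite ltnS !leq_max leqnn !orbT.
have tS n : agree (@eval G X) (S n).1 (S n).2 t.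
  move=> p pD; pose k := maxn n (N p).+1.
  rewrite /eval ta -surjective_pairing -(aE p k) ?leq_maxr //.
  by apply: (SS n k _).1 => //; exact: leq_maxl.
exists t; first exact: (tS 0%N).
by move=> n; have [_ _ _] := stepP (n, S n); apply; exact: (tS n.+1).
Qed.

End baire.

(** * Generic actions and co-amenable stabilizers *)

Section generic.
Local Open Scope classical_set_scope.
Local Open Scope group_scope.
Variables (R : realType) (G : groupType) (X : choiceType).
Hypotheses (cG : countable [set: G]) (cX : ([set: X] #= [set: nat])%card).
Implicit Types (s t : hom_space G X) (x y : X) (K : subgroup_space G).

(** [x] sits at the trivial coset, whose stabilizer in G / K is [K]. *)
Lemma stab_of_glue K s0 s (f : X -> set G + X) x : injective f ->
    (forall g y, f (action_of s g y) = glue s0 g (f y)) ->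
    f x = inl (coset K 1) ->
  stab s x = K.
Proof.
move=> finj fs fx; apply: sub_mem_inj => g.
have gK : f (action_of s g x) = inl (coset K g).
  by rewrite fs fx /= coset_translate mulg1.
apply/stabP/idP => [sgx|Kg].
  by move: gK; rewrite sgx fx => -[/coset_eq]; rewrite invg1 mul1g.
apply: finj; rewrite gK fx; congr inl; apply/esym/coset_eq.
by rewrite invg1 mul1g.
Qed.

(** This gives the density of the open conditions: the orbit of [x] is replaced by the cosets of a
    nearby co-amenable [K]. *)
Lemma perturb_to_coamenable s (P : seq (G * X)) x : A_separable R G ->
  exists2 t, agree (@eval G X) s P t & amenable R (action_of t) (orbit_of t x).
Proof.
move=> sepG.
have /choice[e eP] : forall y, exists g, orbit_of s x y -> action_of s g x = y.
  move=> y; have [[g _ gy]|ny] := pselect (orbit_of s x y); first by exists g.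
  by exists 1 => /ny.
have ex g : action_of s (e (action_of s g x)) x = action_of s g x.
  by apply: eP; exists g.
(* [K] is so close to the stabilizer of [x] that [action_of s g x |-> g K] is
   well-defined, injective and equivariant where [P] can see it. *)
pose D := x :: [seq p.2 | p <- P] ++ [seq eval s p | p <- P].
pose L := e x :: [seq (e y)^-1 * e z | y <- D, z <- D] ++
  [seq (e (eval s p))^-1 * (p.1 * e p.2) | p <- P].
have [|K [KL coK]] := sepG (agree (@sub_mem G) (stab s x) L) _
    (agree_open _ _ (@sub_mem_open G)).
  by exists (stab s x).
have Kstab g : g \in L -> action_of s g x = x <-> sub_mem K g.
  by move=> /KL ->; split=> /stabP.
(* Orbit points become cosets and all others stay in the copy of [X], so collisions can only occur
   between cosets. *)
pose phi y : set G + X :=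
  if `[< orbit_of s x y >] then inl (coset K (e y)) else inr y.
have phiY y : glue_set K (phi y).
  by rewrite /phi; case: ifP => // _; exists (e y).
have phi_inj : {in D &, injective phi}.
  move=> y z yD zD; rewrite /phi.
  case: asboolP => [ys|_]; case: asboolP => [zs|_] // [] // /coset_eq Kyz.
  have /Kstab[_ /(_ Kyz)] : (e y)^-1 * e z \in L.
    by rewrite inE mem_cat (allpairs_f (fun y z => (e y)^-1 * e z)) ?orbT.
  rewrite actionM (eP z zs) => /(congr1 (action_of s (e y))).
  by rewrite actionVK (eP y ys).
have [t [f [finj fphi ft]]] := surgery s cG cX (fun y _ => phiY y) phi_inj.
have xD : x \in D by rewrite inE eqxx.
(* As [e x] fixes [x] and belongs to [L], it lies in [K], so [x] is placed at the trivial coset. *)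
have fx : f x = inl (coset K 1).
  rewrite fphi // /phi asboolT; last by exists 1; rewrite ?action1.
  congr inl; apply/esym/coset_eq; rewrite invg1 mul1g.
  apply/Kstab; first by rewrite inE eqxx.
  by apply: eP; exists 1; rewrite ?action1.
exists t; last by rewrite orbit_amenable (stab_of_glue finj ft fx).
move=> [g y] gyP; apply: finj; rewrite {1}/eval ft.
have yD : y \in D.
  rewrite inE mem_cat; apply/orP; right; apply/orP; left.
  by apply/mapP; exists (g, y).
have gyD : eval s (g, y) \in D.
  by rewrite inE mem_cat (map_f _ gyP) !orbT.
rewrite !fphi // /phi /eval /=.
case: asboolP => [ys|nys]; case: asboolP => [gys|ngys] //=.
(* The element comparing [e (eval s (g, y))] with [g * e y] fixes [x] and is in [L], hence in
   [K]. *)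
- congr inl; rewrite coset_translate; apply/esym/coset_eq; apply/Kstab.
    rewrite inE mem_cat; apply/orP; right; apply/orP; right.
    by apply/mapP; exists (g, y).
  by rewrite !actionM (eP y ys) -{2}(eP _ gys) actionK.
- by case: ngys; exact: orbit_of_stable.
- by case: nys; rewrite -(actionK s g y); exact: orbit_of_stable.
Qed.

(** A Folner set depends on finitely many values of the action: those placing it in the orbit of [x]
    and those giving its translates by [W]. *)
Lemma folner_open x (W : seq G) n :
  open [set s : hom_space G X | folner s (orbit_of s x) W n].
Proof.
apply: open_of_agree => s [E [E0 EO EW]].
have /choice[h hP] : forall y, exists g, y \in E -> action_of s g x = y.
  move=> y; have [/EO[g _ gy]|ny] := boolP (y \in E); first by exists g.
  by exists 1.
exists ([seq (h y, x) | y <- E] ++ [seq (g, y) | g <- W, y <- E]) => t st.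
exists E; split=> // [y /= yE|g gW].
  exists (h y) => //; rewrite -{2}(hP y yE).
  by apply: (st (h y, x)); rewrite mem_cat (map_f (fun y => (h y, x)) yE).
rewrite (_ : [fset action_of t g y | y in E]%fset =
             [fset action_of s g y | y in E]%fset); first exact: EW.
apply: eq_in_imfset => // y yE.
by apply: (st (g, y)); rewrite mem_cat (allpairs_f pair) ?orbT.
Qed.

Lemma comeager_of_separable : A_separable R G ->
  comeager [set s : hom_space G X |
    forall x : X, amenable R (action_of s) (orbit_of s x)].
Proof.
move=> sepG.
have [x _] : [set: X] !=set0.
  by apply: infinite_setN0; rewrite (eq_finite_set cX); exact: infinite_nat.
have [|eX eXP] := countable_enum x; first by rewrite (eq_countable cX).
have [eG eGP] := countable_enum (1%g : G) cG.
have /choice[iG iGP] := eGP.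
(* An index is a point, a finite list in [G] and a precision, coded through the enumerations;
   integers coding nothing are assigned the whole space. *)
pose O (q : nat * seq nat * nat) := [set s : hom_space G X |
  folner s (orbit_of s (eX q.1.1)) (map eG q.1.2) q.2].
pose F k := if choice.unpickle k is Some q then O q else setT.
exists (\bigcap_k F k).
  exists F => // k; rewrite /F; case: choice.unpickle => [q|]; last first.
    by split=> [|A A0 _]; [exact: openT|rewrite setIT].
  split=> [|A [s As] oA]; first exact: folner_open.
  have [P PA] := nbhs_hom (open_nbhs_nbhs (conj oA As)).
  have [t st at_] := perturb_to_coamenable s P (eX q.1.1) sepG.
  exists t; split; first exact: PA.
  by apply: amenable_folner at_ => g y; exact: orbit_of_stable.
move=> s Fs y; apply: folner_amenable => W n.
have [i <-] := eXP y.
(* [iG] is a right inverse of [eG], so this code decodes to [W] itself. *)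
have := Fs (choice.pickle (i, map iG W, n)) I.
rewrite /F choice.pickleK /O /= -map_comp.
by rewrite (eq_map (g := id)) ?map_id.
Qed.

Lemma separable_of_comeager :
  comeager [set s : hom_space G X |
    forall x : X, amenable R (action_of s) (orbit_of s x)] ->
  A_separable R G.
Proof.
move=> [B [U Uod BE] BA] A [K AK] oA.
have [D DA] := nbhs_subgroup (open_nbhs_nbhs (conj oA AK)).
have [x _] : [set: X] !=set0.
  by apply: infinite_setN0; rewrite (eq_finite_set cX); exact: infinite_nat.
(* The trivial action fills up G / K, which may be finite, to a countably infinite set. *)
have [|//|s0 _] := @hom_of_action G X (fun _ => id) => //.
have [||s [f [finj fphi fs]]] :=
  @surgery G X K s0 [:: x] (fun=> inl (coset K 1)) cG cX.
- by move=> y _; exists 1.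
- by move=> y z; rewrite !inE => /eqP-> /eqP->.
have sK : stab s x = K by apply: stab_of_glue finj fs _; rewrite fphi ?inE.
have cX' : countable [set: X] by rewrite (eq_countable cX).
(* Agreement at the pairs [(g, x)] with [g] in [D] decides which elements of [D] fix [x], so the
   stabilizer stays in [A]. *)
have [t st Ut] := hom_baire cG cX' s [seq (g, x) | g <- D] Uod.
exists (stab t x); split.
  apply: DA => g gD; rewrite -sK; apply/stabP/stabP.
    by rewrite -[action_of t g x]/(eval t (g, x)) st ?map_f.
  by rewrite -[action_of t g x]/(eval t (g, x)) st ?map_f.
apply/orbit_amenable; apply: BA; rewrite BE => i _; exact: Ut.
Qed.

End generic.

Theorem theorem1p12 (R : realType) (G : groupType) (X : choiceType)
    (countG : countable [set: G]%classic)
    (countX : ([set: X] #= [set: nat])%card) :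
  A_separable R G <->
  comeager [set s : hom_space G X |
    forall x : X, amenable R (action_of s) (orbit_of s x)]%classic.
Proof.
by split; [exact: comeager_of_separable|exact: separable_of_comeager].
Qed.
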